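(* Consider the piecewise linear regularization $\varphi(v)=v$ for $-1\le v\le1$, let $L>0$, and let $v=m(x;\varepsilon)$ be the invariant manifold described in the context. Fix $0<\lambda<1$ and take any point $(x_0,1)$ with $-L\le x_0\le-\varepsilon^\lambda$. Then the orbit of $$\varepsilon\frac{dv}{dx}=\frac{1+2x+v(2x-1)}{1+v}$$ with initial condition $v(x_0)=1$ stays exponentially close to the invariant manifold $v=m(x;\varepsilon)$ in the region $x\ge0$.
   Context: $\varepsilon$ is a small positive parameter. The equation is that of the orbits of the slow-fast system $\dot x=\frac{1+v}2$, $\varepsilon\dot v=\frac{1+2x}2+\frac v2(2x-1)$ for $-1\le v\le1$, which is the regularization (with $y=\varepsilon v$) of the Filippov system with $X^+=(1,2x)$ for $y>0$ and $X^-=(0,1)$ for $y<0$ using $\varphi(v)=-1$ ($v\le-1$), $v$ ($|v|<1$), $1$ ($v\ge1$). Considered for all $(x,v)\in\mathbb R^2$, this slow-fast system has the slow manifold $v=m_0(x)=\frac{1+2x}{1-2x}$, $x<\frac12$, which is normally hyperbolic attracting for $x\le N$ with any fixed $0<N<\frac12$. Fenichel theory gives, for small $\varepsilon$, a normally hyperbolic invariant manifold $\Lambda_\varepsilon$: $v=m(x;\varepsilon)$, satisfying $1+2x+m(2x-1)=\varepsilon(1+m)m'$ and $m(x;\varepsilon)=m_0(x)-\frac{8\varepsilon}{(1-2x)^4}+O(\varepsilon^2)$. It is the invariant manifold of the regularized system until it reaches $v=1$. *)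

(* Defs.v *)
From Stdlib Require Import Reals.
From Coquelicot Require Import Coquelicot.
Open Scope R_scope.

(* Setting: the slow-fast system
     x' = (1 + v) / 2,   eps v' = (1 + 2 x) / 2 + (v / 2) (2 x - 1),
   considered for all (x, v) and not only for |v| <= 1. *)

Definition slow_rhs (x v : R) : R := 1 + 2 * x + v * (2 * x - 1).

(* Zero set of [slow_rhs]; meaningful for x < 1/2. *)
Definition critical_manifold (x : R) : R := (1 + 2 * x) / (1 - 2 * x).

(* [m x eps] is m(x; eps).  The O(eps^2) is uniform for x in [a, b].
   Derivatives at the end points are two-sided; this loses nothing, since a
   function with one-sided derivatives there can be altered outside [a, b]. *)
Definition fenichel_manifold (a b : R) (m : R -> R -> R) : Prop :=
  exists eps0 K : R, 0 < eps0 /\ 0 < K /\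
  forall eps : R, 0 < eps < eps0 ->
  forall x : R, a <= x <= b ->
    ex_derive (fun t => m t eps) x /\
    slow_rhs x (m x eps)
      = eps * (1 + m x eps) * Derive (fun t => m t eps) x /\
    Rabs (m x eps
          - (critical_manifold x - 8 * eps / (1 - 2 * x) ^ 4))
      <= K * eps ^ 2.

(* The condition [v x <> -1] keeps the solution in the domain of the
   right-hand side, where Rocq's division by zero plays no role. *)
Definition orbit (eps x0 b : R) (v : R -> R) : Prop :=
  v x0 = 1 /\
  forall x : R, x0 <= x <= b ->
    v x <> -1 /\ ex_derive v x /\
    eps * Derive v x = slow_rhs x (v x) / (1 + v x).

(* Main.v *)
Require Import Defs.
From Stdlib Require Import Reals Ranalysis5 Lra.
From Coquelicot Require Import Coquelicot.
Open Scope R_scope.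

(* In terms of w = 1 + v the orbit equation reads eps w' = 2 / w - (1 - 2 x), so
   the difference d of the orbit and the manifold M = 1 + m satisfies
   eps d' = - 2 d / (w M).  Hence |d| decreases, w and M stay bounded, and |d|
   contracts like exp (- k (x - x0) / eps) on all of [x0, N]; for x >= 0 the
   elapsed length x - x0 is at least eps^lambda.  The orbit exists up to N by
   Picard iteration, since w cannot fall below 2 / (1 + 2 L). *)

(** * Continuity in epsilon-delta form and limits of sequences *)

Lemma continuous_eps_delta (f : R -> R) (x : R) :
  (forall e, 0 < e -> exists d, 0 < d /\
     forall y, Rabs (y - x) < d -> Rabs (f y - f x) < e) ->
  continuous f x.
Proof.
intros H; apply filterlim_locally; intros e.
destruct (H e (cond_pos e)) as [d [Hd Hf]].
exists (mkposreal d Hd); intros y Hy; exact (Hf y Hy).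
Qed.

Lemma continuous_eps_delta_inv (f : R -> R) (x : R) :
  continuous f x -> forall e, 0 < e -> exists d, 0 < d /\
     forall y, Rabs (y - x) < d -> Rabs (f y - f x) < e.
Proof.
intros H e He.
destruct (proj1 (filterlim_locally f (f x)) H (mkposreal e He)) as [d Hd].
exists d; split; [apply cond_pos | intros y Hy; exact (Hd y Hy)].
Qed.

Lemma lipschitz_continuous (f : R -> R) (K x : R) :
  (forall y, Rabs (f y - f x) <= K * Rabs (y - x)) -> continuous f x.
Proof.
intros H; apply continuous_eps_delta; intros e He.
(* [K] may have any sign, so the divisor is the positive number [Rabs K + 1]. *)
assert (HK : 0 < Rabs K + 1) by (pose proof (Rabs_pos K); lra).
exists (e / (Rabs K + 1)); split; [now apply Rdiv_lt_0_compat|].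
intros y Hy; apply Rle_lt_trans with (1 := H y).
apply Rlt_div_r in Hy; [|exact HK].
pose proof (Rle_abs K); pose proof (Rabs_pos (y - x)); nra.
Qed.

(** The increment splits into a change of state at fixed time, controlled by the Lipschitz bound,
    and a change of time at the fixed state [u x], controlled by continuity. *)
Lemma continuous_comp_lipschitz (F : R -> R -> R) (K : R) (u : R -> R) (x : R) :
  0 < K ->
  (forall y, continuous (fun t => F t y) x) ->
  (forall t y z, Rabs (F t y - F t z) <= K * Rabs (y - z)) ->
  continuous u x -> continuous (fun t => F t (u t)) x.
Proof.
intros HK HF HL Hu; apply continuous_eps_delta; intros e He.
destruct (continuous_eps_delta_inv _ _ (HF (u x)) (e / 2)) as [d1 [Hd1 H1]];
  [lra|].
destruct (continuous_eps_delta_inv _ _ Hu (e / 2 / K)) as [d2 [Hd2 H2]];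
  [apply Rdiv_lt_0_compat; lra|].
exists (Rmin d1 d2); split; [now apply Rmin_glb_lt|].
intros y Hy.
assert (Hy1 := H1 y (Rlt_le_trans _ _ _ Hy (Rmin_l _ _))).
assert (Hy2 := H2 y (Rlt_le_trans _ _ _ Hy (Rmin_r _ _))).
apply Rlt_div_r in Hy2; [|exact HK].
assert (Hy3 := HL y (u y) (u x)).
replace (F y (u y) - F x (u x))
  with ((F y (u y) - F y (u x)) + (F y (u x) - F x (u x))) by ring.
apply Rle_lt_trans with (1 := Rabs_triang _ _); lra.
Qed.

Lemma uniform_limit_continuous (u : nat -> R -> R) (p : R -> R) (e : nat -> R)
    (x : R) :
  (forall n, continuous (u n) x) -> is_lim_seq e 0 ->
  (forall n t, Rabs (u n t - p t) <= e n) -> continuous p x.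
Proof.
intros Hu He Hp; apply continuous_eps_delta; intros a Ha.
apply is_lim_seq_spec in He.
destruct (He (mkposreal (a / 3) ltac:(lra))) as [n Hn].
specialize (Hn n (le_n n)); simpl in Hn; rewrite Rminus_0_r in Hn.
pose proof (Rle_abs (e n)).
destruct (continuous_eps_delta_inv _ _ (Hu n) (a / 3)) as [d [Hd H1]]; [lra|].
exists d; split; [exact Hd|]; intros y Hy; specialize (H1 y Hy).
pose proof (Hp n x) as Hx; pose proof (Hp n y) as Hy'.
rewrite Rabs_minus_sym in Hy'.
replace (p y - p x) with ((p y - u n y) + ((u n y - u n x) + (u n x - p x)))
  by ring.
apply Rle_lt_trans with (1 := Rabs_triang _ _).
apply Rle_lt_trans with (1 := Rplus_le_compat_l _ _ _ (Rabs_triang _ _)); lra.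
Qed.

Lemma is_lim_seq_scal_half_pow (C : R) :
  is_lim_seq (fun n => C * (1 / 2) ^ n) 0.
Proof.
replace (Finite 0) with (Rbar_mult C 0) by (simpl; f_equal; ring).
apply is_lim_seq_scal_l, is_lim_seq_geom; rewrite Rabs_pos_eq; lra.
Qed.

(** The radius [2 * D * (1 / 2) ^ n] shrinks at step [n] by exactly the largest allowed move of [u].
    So the intervals of this radius about [u n] are nested, and the common limit of their end points
    lies in all of them. *)
Lemma lim_seq_of_geometric_steps (u : nat -> R) (D : R) :
  (forall n, Rabs (u (S n) - u n) <= D * (1 / 2) ^ n) ->
  forall n, Rabs (u n - real (Lim_seq u)) <= 2 * D * (1 / 2) ^ n.
Proof.
intros H.
set (lo := fun n => u n - 2 * D * (1 / 2) ^ n).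
set (up := fun n => u n + 2 * D * (1 / 2) ^ n).
assert (Hlo : forall n, lo n <= lo (S n)).
{ intros n; specialize (H n); apply Rabs_le_between in H.
  unfold lo; simpl; lra. }
assert (Hup : forall n, up (S n) <= up n).
{ intros n; specialize (H n); apply Rabs_le_between in H.
  unfold up; simpl; lra. }
destruct (ex_lim_seq_adj lo up Hlo Hup) as [Hl [Hu E]].
{ apply is_lim_seq_ext with (fun n => 4 * D * (1 / 2) ^ n).
  - intros n; unfold lo, up; ring.
  - apply is_lim_seq_scal_half_pow. }
apply Lim_seq_correct' in Hl; apply Lim_seq_correct' in Hu; rewrite <- E in Hu.
assert (Hlim : is_lim_seq u (real (Lim_seq lo))).
{ apply is_lim_seq_le_le with lo up; [|exact Hl|exact Hu].
  intros n; specialize (H n); pose proof (Rabs_pos (u (S n) - u n)).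
  unfold lo, up; lra. }
rewrite (is_lim_seq_unique _ _ Hlim); simpl; intros n.
pose proof (is_lim_seq_incr_compare _ _ Hl Hlo n).
pose proof (is_lim_seq_decr_compare _ _ Hu Hup n) as Hn.
apply Rabs_le_between; unfold lo, up in *; lra.
Qed.

(** * Picard iteration for globally Lipschitz fields *)

Lemma is_derive_primitive (h : R -> R) (a x : R) :
  (forall t, continuous h t) -> is_derive (RInt h a) x (h x).
Proof.
intros H; apply is_derive_RInt with a; [|apply H].
apply filter_forall; intros y; apply RInt_correct.
apply @ex_RInt_continuous; intros z _; apply H.
Qed.

Definition clamp (a b t : R) : R := Rmax a (Rmin t b).

Lemma clamp_bounds (a b t : R) : a <= b -> a <= clamp a b t <= b.
Proof.
intros H; unfold clamp, Rmax, Rmin; repeat destruct Rle_dec; lra.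
Qed.

Lemma clamp_id (a b t : R) : a <= t <= b -> clamp a b t = t.
Proof.
intros H; unfold clamp, Rmax, Rmin; repeat destruct Rle_dec; lra.
Qed.

Lemma clamp_continuous (a b t : R) : a <= b -> continuous (clamp a b) t.
Proof.
intros Hab; apply lipschitz_continuous with 1; intros y.
unfold clamp, Rmax, Rmin, Rabs.
repeat destruct Rle_dec; repeat destruct Rcase_abs; lra.
Qed.

(* Clamping time to [a, b] makes the iterates defined and continuous on the
   whole line with estimates uniform in t, and gives the limit a two-sided
   derivative at both end points. *)
Fixpoint picard (F : R -> R -> R) (a b y0 : R) (n : nat) (t : R) : R :=
  match n with
  | O => y0
  | S n => y0 + RInt (fun s => F (clamp a b s) (picard F a b y0 n s)) a
                  (clamp a b t)
  end.

Lemma continuous_clamped_field (F : R -> R -> R) (K a b : R) (u : R -> R) :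
  0 < K -> a <= b -> (forall x y, continuous (fun t => F t y) x) ->
  (forall t y z, Rabs (F t y - F t z) <= K * Rabs (y - z)) ->
  (forall t, continuous u t) ->
  forall t, continuous (fun s => F (clamp a b s) (u s)) t.
Proof.
intros HK Hab HF HL Hu t.
apply continuous_comp_lipschitz with (F := fun s y => F (clamp a b s) y) (K := K);
  auto.
intros y; apply (continuous_comp (clamp a b) (fun s => F s y)); [|apply HF].
now apply clamp_continuous.
Qed.

Lemma picard_continuous (F : R -> R -> R) (K a b y0 : R) (n : nat) :
  0 < K -> a <= b -> (forall x y, continuous (fun t => F t y) x) ->
  (forall t y z, Rabs (F t y - F t z) <= K * Rabs (y - z)) ->
  forall t, continuous (picard F a b y0 n) t.
Proof.
intros HK Hab HF HL; induction n as [|n IH]; intros t; simpl.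
- apply continuous_const.
- apply @continuous_plus; [apply continuous_const|].
  apply (continuous_comp (clamp a b)
    (RInt (fun s => F (clamp a b s) (picard F a b y0 n s)) a)).
  + now apply clamp_continuous.
  + apply @ex_derive_continuous; eexists; apply is_derive_primitive.
    now apply continuous_clamped_field with K.
Qed.

(** The majorant [g] stays general for two uses: an exponential one gives the contraction of a
    Picard step, a constant one the passage to the limit. *)
Lemma RInt_field_dist (F : R -> R -> R) (K a b c : R) (u v g : R -> R) (lg : R) :
  0 < K -> a <= c <= b -> (forall x y, continuous (fun t => F t y) x) ->
  (forall t y z, Rabs (F t y - F t z) <= K * Rabs (y - z)) ->
  (forall t, continuous u t) -> (forall t, continuous v t) ->
  (forall t, a <= t <= c -> K * Rabs (u t - v t) <= g t) ->
  is_RInt g a c lg ->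
  Rabs (RInt (fun s => F (clamp a b s) (u s)) a c
        - RInt (fun s => F (clamp a b s) (v s)) a c) <= lg.
Proof.
intros HK Hc HF HL Hu Hv Hg Ig.
assert (Hi : forall w, (forall t, continuous w t) ->
  is_RInt (fun s => F (clamp a b s) (w s)) a c
    (RInt (fun s => F (clamp a b s) (w s)) a c)).
{ intros w Hw; apply @RInt_correct, @ex_RInt_continuous; intros z _.
  apply continuous_clamped_field with K; auto; lra. }
apply (norm_RInt_le (fun s => minus (F (clamp a b s) (u s)) (F (clamp a b s) (v s)))
  g a c (minus (RInt (fun s => F (clamp a b s) (u s)) a c)
        (RInt (fun s => F (clamp a b s) (v s)) a c)) lg); [lra| |
  apply @is_RInt_minus; apply Hi; assumption | exact Ig].
intros x Hx; eapply Rle_trans; [apply HL | now apply Hg].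
Qed.

Lemma exp_nondecreasing (x y : R) : x <= y -> exp x <= exp y.
Proof.
intros [H | ->]; [now apply Rlt_le, exp_increasing | apply Rle_refl].
Qed.

(* The weight [exp (2 K (t - a))] makes the Picard map a contraction of
   ratio 1/2 whatever the length of [a, b]. *)
Lemma picard_step (F : R -> R -> R) (K a b y0 : R) :
  0 < K -> a <= b -> (forall x y, continuous (fun t => F t y) x) ->
  (forall t y z, Rabs (F t y - F t z) <= K * Rabs (y - z)) ->
  exists A, forall n t,
    Rabs (picard F a b y0 (S n) t - picard F a b y0 n t)
      <= A * (1 / 2) ^ n * exp (2 * K * (clamp a b t - a)).
Proof.
intros HK Hab HF HL.
pose proof (fun n => picard_continuous F K a b y0 n HK Hab HF HL) as Hc.
(* [A] is the maximum over [a, b] of the first Picard increment. It bounds that increment on the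
   whole line, since iterates depend on [t] only through its clamp. *)
destruct (continuity_ab_maj
  (fun t => Rabs (picard F a b y0 1 t - y0)) a b Hab) as [M [HM _]].
{ intros c _; apply continuity_pt_filterlim.
  apply (continuous_Rabs_comp (fun t => picard F a b y0 1 t - y0)).
  apply @continuous_minus; [apply Hc | apply continuous_const]. }
set (A := Rabs (picard F a b y0 1 M - y0)) in HM.
assert (HA : 0 <= A) by apply Rabs_pos.
exists A; induction n as [|n IH]; intros t;
  pose proof (clamp_bounds a b t Hab) as Ht.
- assert (H1 := HM _ Ht).
  simpl in H1 |- *; rewrite (clamp_id a b (clamp a b t) Ht) in H1.
  assert (1 <= exp (2 * K * (clamp a b t - a))).
  { rewrite <- exp_0; apply exp_nondecreasing; nra. }
  nra.
- set (P := picard F a b y0) in *.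
  change (P (S (S n)) t) with
    (y0 + RInt (fun s => F (clamp a b s) (P (S n) s)) a (clamp a b t)).
  change (P (S n) t) with
    (y0 + RInt (fun s => F (clamp a b s) (P n s)) a (clamp a b t)).
  match goal with |- Rabs (y0 + ?x - (y0 + ?y)) <= _ =>
    replace (y0 + x - (y0 + y)) with (x - y) by ring end.
  set (C := A * (1 / 2) ^ n).
  assert (HC : 0 <= C) by (apply Rmult_le_pos; [|apply pow_le]; lra).
  (* A primitive of [K * (C * exp (2 * K * (s - a)))] is [C / 2 * exp (2 * K * (s - a))]; this is
     the source of the ratio 1/2. *)
  apply Rle_trans with
    (minus (C / 2 * exp (2 * K * (clamp a b t - a)))
           (C / 2 * exp (2 * K * (a - a)))).
  + apply RInt_field_dist with (K := K)
      (g := fun s => K * (C * exp (2 * K * (s - a)))); auto; try apply Hc.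
    * intros s Hs; apply Rmult_le_compat_l; [lra|].
      rewrite <- (clamp_id a b s) at 3 by lra; apply IH.
    * apply (is_RInt_derive (fun s => C / 2 * exp (2 * K * (s - a)))).
      -- intros s _; auto_derive; [trivial | unfold Rminus; field].
      -- intros s _; apply @ex_derive_continuous; auto_derive; trivial.
  + unfold minus, plus, opp; simpl.
    pose proof (exp_pos (2 * K * (a - a))).
    replace (A * (1 / 2 * (1 / 2) ^ n)) with (C / 2) by (unfold C; field).
    nra.
Qed.

Lemma picard_lindelof (F : R -> R -> R) (K a b y0 : R) :
  0 < K -> a <= b -> (forall x y, continuous (fun t => F t y) x) ->
  (forall t y z, Rabs (F t y - F t z) <= K * Rabs (y - z)) ->
  exists u : R -> R, u a = y0 /\
    forall x, a <= x <= b -> is_derive u x (F x (u x)).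
Proof.
intros HK Hab HF HL.
destruct (picard_step F K a b y0 HK Hab HF HL) as [A HA].
pose proof (fun n => picard_continuous F K a b y0 n HK Hab HF HL) as Hc.
set (D := A * exp (2 * K * (b - a))).
set (P := picard F a b y0) in *.
(* The case [n = 0] bounds an absolute value by [A] times an exponential, which forces the sign of
   [A]. *)
assert (HA0 : 0 <= A).
{ specialize (HA 0%nat a); simpl in HA.
  pose proof (exp_pos (2 * K * (clamp a b a - a))).
  pose proof (Rabs_pos (P 1%nat a - P 0%nat a)); simpl in *.
  apply Rnot_lt_le; intros Hn; nra. }
set (p := fun t => real (Lim_seq (fun n => P n t))).
assert (Hp : forall n t, Rabs (P n t - p t) <= 2 * D * (1 / 2) ^ n).
{ intros n t; apply (lim_seq_of_geometric_steps (fun n => P n t)); clear n.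
  intros n; eapply Rle_trans; [apply HA|]; unfold D.
  pose proof (clamp_bounds a b t Hab).
  assert (exp (2 * K * (clamp a b t - a)) <= exp (2 * K * (b - a)))
    by (apply exp_nondecreasing; nra).
  assert (0 <= A * (1 / 2) ^ n) by (apply Rmult_le_pos; [|apply pow_le]; lra).
  nra. }
assert (Hpc : forall t, continuous p t).
{ intros t; apply uniform_limit_continuous
    with P (fun n => 2 * D * (1 / 2) ^ n); auto.
  apply is_lim_seq_scal_half_pow. }
set (h := fun s => F (clamp a b s) (p s)).
assert (Hh : forall t, continuous h t)
  by now apply continuous_clamped_field with K.
assert (Hfix : forall t, p t = y0 + RInt h a (clamp a b t)).
{ intros t; pose proof (clamp_bounds a b t Hab) as Ht.
  apply Rminus_diag_uniq, Rabs_eq_0.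
  apply Rle_antisym; [|apply Rabs_pos].
  (* The defect in the fixed point equation is at most the distance from [p] to iterate [S n] plus
     the effect of replacing iterate [n] by [p] under the integral. Their sum is at most
     [C * (1 / 2) ^ n], which tends to 0. *)
  set (C := 2 * D * (1 + K * (b - a))).
  assert (HC := is_lim_seq_scal_half_pow C).
  change (Rbar_le (Rabs (p t - (y0 + RInt h a (clamp a b t)))) 0).
  refine (is_lim_seq_le _ _ _ _ _ (is_lim_seq_const _) HC); intros n.
  assert (H1 := Hp (S n) t); rewrite Rabs_minus_sym in H1.
  assert (H2 : Rabs (RInt (fun s => F (clamp a b s) (P n s)) a (clamp a b t)
                     - RInt h a (clamp a b t))
    <= scal (clamp a b t - a) (K * (2 * D * (1 / 2) ^ n))).
  { apply RInt_field_dist with (K := K)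
      (g := fun _ => K * (2 * D * (1 / 2) ^ n)); auto; try apply Hc.
    - intros s _; apply Rmult_le_compat_l; [lra | apply Hp].
    - apply @is_RInt_const. }
  unfold scal in H2; simpl in H2; unfold mult in H2; simpl in H2.
  change (P (S n) t) with
    (y0 + RInt (fun s => F (clamp a b s) (P n s)) a (clamp a b t)) in H1.
  replace (p t - (y0 + RInt h a (clamp a b t))) with
    ((p t - (y0 + RInt (fun s => F (clamp a b s) (P n s)) a (clamp a b t)))
     + (RInt (fun s => F (clamp a b s) (P n s)) a (clamp a b t)
        - RInt h a (clamp a b t))) by ring.
  eapply Rle_trans; [apply Rabs_triang|].
  assert (HD : 0 <= D * (1 / 2) ^ n).
  { apply Rmult_le_pos; [apply Rmult_le_pos|apply pow_le];
      [lra | apply Rlt_le, exp_pos | lra]. }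
  assert (0 <= K * (D * (1 / 2) ^ n)) by (apply Rmult_le_pos; lra).
  assert (0 <= (b - clamp a b t) * (K * (D * (1 / 2) ^ n)))
    by (apply Rmult_le_pos; lra).
  unfold C; simpl in H1; nra. }
(* The witness drops the clamp in the upper limit: [p] is constant outside [a, b], so it could have
   a corner at an end point. *)
exists (fun x => y0 + RInt h a x); split.
- rewrite RInt_point; apply Rplus_0_r.
- intros x Hx.
  replace (F x (y0 + RInt h a x)) with (h x).
  + replace (h x) with (0 + h x) by ring.
    apply @is_derive_plus; [apply @is_derive_const | now apply is_derive_primitive].
  + unfold h at 1; rewrite Hfix, clamp_id by lra; reflexivity.
Qed.

(** * Differential inequalities and contraction of differences *)

Lemma nonincreasing_of_derive (f df : R -> R) (a b : R) :
  (forall x, a <= x <= b -> is_derive f x (df x) /\ df x <= 0) ->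
  forall x, a <= x <= b -> f x <= f a.
Proof.
intros H x Hx.
destruct (MVT_gen f a x df) as [c [Hc E]];
  rewrite ?Rmin_left, ?Rmax_right in * by lra.
- intros t Ht; apply H; lra.
- intros t Ht; apply continuity_pt_filterlim, @ex_derive_continuous.
  eexists; apply H; lra.
- destruct (H c) as [_ Hd]; [lra|]; nra.
Qed.

(** The corner of [Rabs] at 0 is smoothed by the factor [s]; this makes the square of the negative
    part of a function differentiable. *)
Lemma is_derive_mult_Rabs (x : R) : is_derive (fun s => s * Rabs s) x (2 * Rabs x).
Proof.
destruct (Req_dec x 0) as [-> | Hx].
- apply is_derive_Reals; intros e He; exists (mkposreal e He); intros h Hh Hd.
  rewrite Rplus_0_l, Rabs_R0, Rmult_0_l, Rmult_0_r, !Rminus_0_r.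
  replace (h * Rabs h / h) with (Rabs h) by now field.
  now rewrite Rabs_Rabsolu.
- auto_derive; [tauto|].
  destruct (Rlt_le_dec x 0) as [Hn | Hp].
  + rewrite sign_eq_m1, Rabs_left by lra; ring.
  + rewrite sign_eq_1, Rabs_right by lra; ring.
Qed.

(* The C^1 function [(f^2 - f |f|) / 2 = min(f, 0)^2] is nonincreasing. *)
Lemma nonneg_of_derive_nonneg_below (f df : R -> R) (a b : R) :
  0 <= f a ->
  (forall x, a <= x <= b -> is_derive f x (df x)) ->
  (forall x, a <= x <= b -> f x < 0 -> 0 <= df x) ->
  forall x, a <= x <= b -> 0 <= f x.
Proof.
intros Ha Hf Hd x Hx.
assert (H : f x ^ 2 - f x * Rabs (f x) <= f a ^ 2 - f a * Rabs (f a)).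
{ apply (nonincreasing_of_derive (fun t => f t ^ 2 - f t * Rabs (f t))
    (fun t => df t * (2 * f t) - df t * (2 * Rabs (f t))) a b); [|exact Hx].
  intros t Ht; split.
  - apply @is_derive_minus.
    + apply (is_derive_comp (fun s => s ^ 2) f); [|now apply Hf].
      auto_derive; [trivial | ring].
    + apply (is_derive_comp (fun s => s * Rabs s) f);
        [apply is_derive_mult_Rabs | now apply Hf].
  - destruct (Rlt_le_dec (f t) 0) as [Hn | Hp].
    + rewrite Rabs_left by lra; specialize (Hd t Ht Hn); nra.
    + rewrite Rabs_right by lra; lra. }
rewrite (Rabs_right (f a)) in H by lra.
apply Rnot_lt_le; intros Hn; rewrite Rabs_left in H by lra; nra.
Qed.

(* With [w = 1 + v] the orbit equation is [eps w' = 2 / w - (1 - 2 x)], and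
   the difference [d] of two solutions [w], [M] obeys [eps d' = - 2 d / (w M)]. *)
Lemma shifted_orbits_exp_close (q w M : R -> R) (eps a b B D : R) :
  0 < eps -> 0 < B -> 0 < D ->
  (forall x, a <= x <= b ->
     0 < w x /\ is_derive w x ((2 / w x - q x) / eps)) ->
  (forall x, a <= x <= b ->
     0 < M x <= B /\ is_derive M x ((2 / M x - q x) / eps)) ->
  Rabs (w a - M a) <= D ->
  forall x, a <= x <= b ->
    Rabs (w x - M x) <= D * exp (- (2 / (B * (B + D))) * (x - a) / eps).
Proof.
intros He HB HD Hw HM Ha.
set (d := fun x => w x - M x).
assert (Dd : forall x, a <= x <= b ->
  is_derive d x (- (2 / (eps * (w x * M x))) * d x)).
{ intros x Hx; destruct (Hw x Hx) as [W Dw]; destruct (HM x Hx) as [HMx DM].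
  replace (- (2 / (eps * (w x * M x))) * d x) with
    (minus ((2 / w x - q x) / eps) ((2 / M x - q x) / eps))
    by (unfold minus, plus, opp, d; simpl; field; lra).
  now apply @is_derive_minus. }
(* First a bound without rate: the square of [d] does not increase. It yields [w <= B + D], from
   which the rate is then obtained. *)
assert (H1 : forall x, a <= x <= b -> Rabs (d x) <= D).
{ intros x Hx; apply Rle_trans with (2 := Ha); apply Rsqr_le_abs_0.
  unfold Rsqr; fold (d a).
  apply (nonincreasing_of_derive (fun t => d t * d t)
    (fun t => 2 * (- (2 / (eps * (w t * M t))) * d t) * d t) a b);
    [|exact Hx].
  intros t Ht; destruct (Hw t Ht) as [W _]; destruct (HM t Ht) as [[HMt _] _].
  split.
  - replace (2 * (- (2 / (eps * (w t * M t))) * d t) * d t) with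
      (- (2 / (eps * (w t * M t))) * d t * d t
       + d t * (- (2 / (eps * (w t * M t))) * d t)) by ring.
    apply (is_derive_mult d d t); try apply Rmult_comm; now apply Dd.
  - assert (0 < 2 / (eps * (w t * M t)))
      by (apply Rdiv_lt_0_compat; [lra | repeat apply Rmult_lt_0_compat; lra]).
    pose proof (Rle_0_sqr (d t)); unfold Rsqr in *; nra. }
(* Since [M <= B] and [w <= M + Rabs d <= B + D], the product [w * M] is at most [B * (B + D)]. *)
set (k := 2 / (B * (B + D))).
assert (Hk : forall x, a <= x <= b -> k <= 2 / (w x * M x)).
{ intros x Hx; destruct (Hw x Hx) as [W _]; destruct (HM x Hx) as [HMx _].
  assert (Hd := H1 x Hx); apply Rabs_le_between in Hd; unfold d in Hd.
  apply Rmult_le_compat_l; [lra|]; apply Rinv_le_contravar; nra. }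
intros x Hx; fold (d x).
(* The weight grows at rate [k / eps], no faster than [d] decays, so the square of [d * E] does not
   increase. *)
set (E := fun t => exp (k * (t - a) / eps)).
assert (H2 : (d x * E x) * (d x * E x) <= (d a * E a) * (d a * E a)).
{ apply (nonincreasing_of_derive (fun t => (d t * E t) * (d t * E t))
    (fun t => 2 * (d t * E t) * (- (2 / (eps * (w t * M t))) * d t * E t
                              + d t * (k / eps * E t))) a b); [|exact Hx].
  intros t Ht; destruct (Hw t Ht) as [W _]; destruct (HM t Ht) as [[HMt _] _].
  assert (DE : is_derive (fun t => d t * E t) t
    (- (2 / (eps * (w t * M t))) * d t * E t + d t * (k / eps * E t))).
  { apply (is_derive_mult d E t); try apply Rmult_comm; [now apply Dd|].
    unfold E; auto_derive; [trivial | unfold Rminus, Rdiv; ring]. }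
  split.
  - match goal with |- is_derive _ _ (2 * ?u * ?v) =>
      replace (2 * u * v) with (v * u + u * v) by ring end.
    apply (is_derive_mult (fun t => d t * E t) (fun t => d t * E t) t);
      try apply Rmult_comm; exact DE.
  - replace (2 * (d t * E t) * (- (2 / (eps * (w t * M t))) * d t * E t
                              + d t * (k / eps * E t))) with
      (- (2 / eps * (d t * E t)² * (2 / (w t * M t) - k)))
      by (unfold Rsqr; field; lra).
    pose proof (Hk t Ht); pose proof (Rle_0_sqr (d t * E t)).
    assert (0 < 2 / eps) by (apply Rdiv_lt_0_compat; lra).
    assert (0 <= 2 / eps * (d t * E t)² * (2 / (w t * M t) - k))
      by (apply Rmult_le_pos; [apply Rmult_le_pos|]; lra).
    lra. }
apply Rsqr_le_abs_0 in H2.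
replace (E a) with 1 in H2
  by (unfold E; rewrite <- exp_0; f_equal; field; lra).
rewrite Rmult_1_r, Rabs_mult, (Rabs_pos_eq (E x)) in H2
  by (apply Rlt_le, exp_pos).
replace (exp (- k * (x - a) / eps)) with (/ E x)
  by (unfold E; rewrite <- exp_Ropp; f_equal; field; lra).
apply Rle_div_r; [apply exp_pos | unfold d at 2 in H2; lra].
Qed.

(** * Existence and positivity of orbits *)

Lemma orbit_rhs_shift (x v : R) :
  1 + v <> 0 -> slow_rhs x v / (1 + v) = 2 / (1 + v) - (1 - 2 * x).
Proof. intros H; unfold slow_rhs; now field. Qed.

Lemma Rmax_lipschitz (d y z : R) : Rabs (Rmax y d - Rmax z d) <= Rabs (y - z).
Proof.
unfold Rmax, Rabs; repeat destruct Rle_dec; repeat destruct Rcase_abs; lra.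
Qed.

(* Below [w = delta] the right-hand side is nonnegative, so truncating [2 / w]
   at [delta] makes it globally Lipschitz without changing the solution. *)
Lemma orbit_exists (eps L x0 b : R) :
  0 < eps -> - L <= x0 <= b -> 0 < L ->
  exists v : R -> R, orbit eps x0 b v.
Proof.
intros He Hx0 HL.
(* Chosen so that [2 / delta = 1 + 2 * L], which dominates [1 - 2 * x] for all [x >= - L]. *)
set (delta := 2 / (1 + 2 * L)).
assert (Hdelta : 0 < delta) by (apply Rdiv_lt_0_compat; lra).
assert (Hd2 : delta < 2) by (apply Rlt_div_l; lra).
assert (Hdq : 2 / delta = 1 + 2 * L) by (unfold delta; field; lra).
set (F := fun x w => (2 / Rmax w delta - (1 - 2 * x)) / eps).
(* The Lipschitz constant comes from [2 / Y - 2 / Z = - 2 * (Y - Z) / (Y * Z)] with [Y] and [Z] at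
   least [delta]; the initial value 2 is [1 + v x0]. *)
destruct (picard_lindelof F (2 / (delta * delta) / eps) x0 b 2)
  as [w [Hw0 Hw]].
- repeat apply Rdiv_lt_0_compat; nra.
- lra.
- intros x y; unfold F; apply @ex_derive_continuous; auto_derive; trivial.
- intros t y z; unfold F.
  pose proof (Rmax_r y delta); pose proof (Rmax_r z delta).
  pose proof (Rmax_lipschitz delta y z) as Hl.
  set (Y := Rmax y delta) in *; set (Z := Rmax z delta) in *.
  replace ((2 / Y - (1 - 2 * t)) / eps - (2 / Z - (1 - 2 * t)) / eps)
    with (2 / (Y * Z) / eps * - (Y - Z)) by (field; lra).
  rewrite Rabs_mult, Rabs_Ropp, Rabs_pos_eq
    by (apply Rlt_le; repeat apply Rdiv_lt_0_compat; nra).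
  apply Rmult_le_compat; [|apply Rabs_pos| |exact Hl].
  + apply Rlt_le; repeat apply Rdiv_lt_0_compat; nra.
  + apply Rmult_le_compat_r; [apply Rlt_le, Rinv_0_lt_compat, He|].
    apply Rmult_le_compat_l; [lra|]; apply Rinv_le_contravar; nra.
- assert (Hpos : forall x, x0 <= x <= b -> delta <= w x).
  { intros x Hx; apply Rminus_le_0.
    apply (nonneg_of_derive_nonneg_below (fun t => w t - delta)
      (fun t => F t (w t)) x0 b); auto.
    - rewrite Hw0; lra.
    - intros t Ht; replace (F t (w t)) with (minus (F t (w t)) 0)
        by apply Rminus_0_r.
      apply @is_derive_minus; [apply Hw; exact Ht | apply @is_derive_const].
    - intros t Ht Hn; unfold F; rewrite Rmax_right, Hdq by lra.
      apply Rle_div_r; lra. }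
  exists (fun x => w x - 1); split; [rewrite Hw0; ring|]; intros x Hx.
  specialize (Hpos x Hx).
  assert (Dv : is_derive (fun x => w x - 1) x (F x (w x))).
  { replace (F x (w x)) with (minus (F x (w x)) 0) by apply Rminus_0_r.
    apply @is_derive_minus; [now apply Hw | apply @is_derive_const]. }
  repeat split; [lra | exists (F x (w x)); exact Dv |].
  apply is_derive_unique in Dv; rewrite orbit_rhs_shift by lra.
  transitivity (eps * F x (w x)); [now f_equal|].
  unfold F; rewrite Rmax_left by exact Hpos.
  replace (1 + (w x - 1)) with (w x) by ring; field; lra.
Qed.

(** The shifted orbit starts at 2 and is continuous; by the intermediate value theorem, losing
    positivity would make it vanish somewhere, which [v x <> -1] excludes. *)
Lemma orbit_shift_pos (eps x0 b : R) (v : R -> R) :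
  orbit eps x0 b v -> forall x, x0 <= x <= b -> 0 < 1 + v x.
Proof.
intros [H0 H] x Hx; apply Rnot_le_lt; intros Hn.
destruct (H x Hx) as [Hne _].
assert (x0 < x).
{ destruct (Req_dec x0 x) as [E|E]; [|lra]; rewrite <- E in Hn; lra. }
destruct (IVT_interv (fun t => - (1 + v t)) x0 x) as [z [Hz E]]; try lra.
- intros t Ht; apply continuity_pt_filterlim.
  apply (ex_derive_continuous (fun t => - (1 + v t))).
  destruct (H t) as [_ [[l Dl] _]]; [lra|].
  auto_derive; now exists l.
- destruct (H z) as [Hne' _]; lra.
Qed.

(** * The orbit and the invariant manifold in the variable 1 + v *)

Lemma is_derive_shift (f : R -> R) (x : R) :
  ex_derive f x -> is_derive (fun t => 1 + f t) x (Derive f x).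
Proof.
intros H; replace (Derive f x) with (plus 0 (Derive f x)) by apply Rplus_0_l.
apply @is_derive_plus; [apply @is_derive_const | now apply Derive_correct].
Qed.

Lemma orbit_shift_derive (eps x0 b : R) (v : R -> R) :
  0 < eps -> orbit eps x0 b v -> forall x, x0 <= x <= b ->
  is_derive (fun t => 1 + v t) x ((2 / (1 + v x) - (1 - 2 * x)) / eps).
Proof.
intros He Ho x Hx; pose proof (orbit_shift_pos _ _ _ _ Ho x Hx) as Hp.
destruct Ho as [_ H]; destruct (H x Hx) as [_ [Hd E]].
rewrite <- orbit_rhs_shift, <- E by lra.
replace (eps * Derive v x / eps) with (Derive v x) by (field; lra).
now apply is_derive_shift.
Qed.

(** The shifted critical manifold [2 / (1 - 2 * x)] lies between [2 / (1 + 2 * L)] and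
    [2 / (1 - 2 * N)], and the expansion in [eps] moves it by at most [eps * Q]. Once positivity is
    known, the invariance equation can be divided by [1 + m x eps]. *)
Lemma fenichel_manifold_shift (L N : R) (m : R -> R -> R) :
  0 < L -> 0 < N < 1 / 2 -> fenichel_manifold (- L) N m ->
  exists eps0 : R, 0 < eps0 /\ forall eps, 0 < eps < eps0 ->
  forall x, - L <= x <= N ->
    0 < 1 + m x eps <= 2 / (1 - 2 * N) + 1 /\
    is_derive (fun t => 1 + m t eps) x
      ((2 / (1 + m x eps) - (1 - 2 * x)) / eps).
Proof.
intros HL HN [e1 [K [He1 [HK H]]]].
set (Q := 8 / (1 - 2 * N) ^ 4 + K).
assert (HN4 : 0 < (1 - 2 * N) ^ 4) by (apply pow_lt; lra).
assert (HQ8 : 0 < 8 / (1 - 2 * N) ^ 4) by (apply Rdiv_lt_0_compat; lra).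
assert (HQ : 0 < Q) by (unfold Q; lra).
assert (HQL : 0 < (1 + 2 * L) * Q) by (apply Rmult_lt_0_compat; lra).
(* [eps < 1] turns [eps ^ 2] into [eps]; the last bound makes [eps * Q] smaller than
   [1 / (1 + 2 * L)], half the lower bound of the shifted critical manifold and itself below 1. *)
exists (Rmin e1 (Rmin 1 (1 / ((1 + 2 * L) * Q)))); split.
{ repeat apply Rmin_glb_lt; try lra; apply Rdiv_lt_0_compat; lra. }
intros eps [He Hlt] x Hx.
apply Rmin_Rgt_l in Hlt; destruct Hlt as [Hlt1 Hlt].
apply Rmin_Rgt_l in Hlt; destruct Hlt as [Hlt2 Hlt3].
apply Rlt_gt, Rlt_div_r in Hlt3; [|exact HQL].
destruct (H eps (conj He Hlt1) x Hx) as [Hd [E Hm]].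
unfold critical_manifold in Hm; apply Rabs_le_between in Hm.
assert (Hxp : 0 < 1 - 2 * x) by lra.
replace ((1 + 2 * x) / (1 - 2 * x)) with (2 / (1 - 2 * x) - 1) in Hm
  by (field; lra).
assert (H1 : 2 / (1 + 2 * L) <= 2 / (1 - 2 * x))
  by (apply Rmult_le_compat_l; [lra | apply Rinv_le_contravar; lra]).
assert (H2 : 2 / (1 - 2 * x) <= 2 / (1 - 2 * N))
  by (apply Rmult_le_compat_l; [lra | apply Rinv_le_contravar; lra]).
assert (H3 : 8 * eps / (1 - 2 * x) ^ 4 <= eps * (8 / (1 - 2 * N) ^ 4)).
{ replace (eps * (8 / (1 - 2 * N) ^ 4)) with (8 * eps / (1 - 2 * N) ^ 4)
    by (field; lra).
  apply Rmult_le_compat_l; [lra|]; apply Rinv_le_contravar; [lra|].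
  apply pow_incr; lra. }
assert (H4 : 0 < 8 * eps / (1 - 2 * x) ^ 4)
  by (apply Rdiv_lt_0_compat; [lra | now apply pow_lt]).
assert (H5 : K * eps ^ 2 <= eps * K) by nra.
assert (H6 : eps * Q < 1 / (1 + 2 * L))
  by (apply (proj1 (Rlt_div_r (eps * Q) 1 (1 + 2 * L) ltac:(lra))); now rewrite Rmult_assoc, (Rmult_comm Q)).
assert (H7 : 1 / (1 + 2 * L) < 1) by (apply Rlt_div_l; lra).
assert (H8 : 2 / (1 + 2 * L) = 2 * (1 / (1 + 2 * L))) by (field; lra).
assert (H9 : 0 < 1 / (1 + 2 * L)) by (apply Rdiv_lt_0_compat; lra).
assert (Hpos : 0 < 1 + m x eps) by (unfold Q in H6; nra).
split; [split; [exact Hpos | unfold Q in H6; nra]|].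
rewrite <- orbit_rhs_shift, E by lra.
replace (eps * (1 + m x eps) * Derive (fun t => m t eps) x / (1 + m x eps) / eps)
  with (Derive (fun t => m t eps) x) by (field; lra).
now apply is_derive_shift.
Qed.

(** * Exponential closeness with uniform constants *)

Theorem proposition3p4 (L N lambda : R) (m : R -> R -> R)
  (hL : 0 < L) (hN : 0 < N < 1 / 2) (hlambda : 0 < lambda < 1)
  (hm : fenichel_manifold (- L) N m) :
  exists eps0 K c : R, 0 < eps0 /\ 0 < K /\ 0 < c /\
  forall eps : R, 0 < eps < eps0 ->
  forall x0 : R, - L <= x0 <= - Rpower eps lambda ->
    (exists v : R -> R, orbit eps x0 N v) /\
    (forall v : R -> R, orbit eps x0 N v ->
     forall x : R, 0 <= x <= N ->
       Rabs (v x - m x eps) <= K * exp (- c / Rpower eps (1 - lambda))).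
Proof.
destruct (fenichel_manifold_shift L N m hL hN hm) as [eps0 [Heps0 HM]].
set (B := 2 / (1 - 2 * N) + 1) in HM.
assert (HB : 0 < B).
{ assert (0 < 2 / (1 - 2 * N)) by (apply Rdiv_lt_0_compat; lra); unfold B; lra. }
assert (Hc : 0 < 2 / (B * (B + (B + 2)))) by (apply Rdiv_lt_0_compat; nra).
(* At [x0] the shifted orbit is 2 and the shifted manifold lies in (0, B], so [D = B + 2] bounds
   their distance for every [x0] and [eps]. The last witness is the contraction rate for this
   [D]. *)
exists eps0, (B + 2), (2 / (B * (B + (B + 2)))).
split; [exact Heps0|]; split; [lra|]; split; [exact Hc|].
intros eps He x0 Hx0.
pose proof (exp_pos (lambda * ln eps)) as Hpow; fold (Rpower eps lambda) in Hpow.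
split; [apply orbit_exists with L; lra|].
intros v Hv x Hx.
replace (v x - m x eps) with ((1 + v x) - (1 + m x eps)) by ring.
apply Rle_trans with
  ((B + 2) * exp (- (2 / (B * (B + (B + 2)))) * (x - x0) / eps)).
- apply (shifted_orbits_exp_close (fun x => 1 - 2 * x)
    (fun x => 1 + v x) (fun x => 1 + m x eps) eps x0 N); [lra | lra | lra | | | | lra].
  + intros t Ht; split; [now apply orbit_shift_pos with eps x0 N|].
    apply orbit_shift_derive with x0 N; tauto.
  + intros t Ht; apply HM; lra.
  + destruct (HM eps He x0) as [Hm _]; [lra|].
    destruct Hv as [-> _]; apply Rabs_le_between; lra.
(* As [x >= 0] and [x0 <= - Rpower eps lambda], the length [x - x0] is at least [Rpower eps lambda];
   division by [eps] leaves the power [lambda - 1]. *)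
- apply Rmult_le_compat_l; [lra|]; apply exp_nondecreasing.
  set (c := 2 / (B * (B + (B + 2)))) in *.
  assert (E : Rpower eps lambda / eps = / Rpower eps (1 - lambda)).
  { rewrite <- Rpower_Ropp.
    replace (- (1 - lambda)) with (lambda + - (1)) by ring.
    rewrite Rpower_plus, Rpower_Ropp, Rpower_1 by lra; reflexivity. }
  replace (- c / Rpower eps (1 - lambda)) with (- c * (Rpower eps lambda / eps))
    by (rewrite E; reflexivity).
  replace (- c * (x - x0) / eps) with (- c * ((x - x0) / eps)) by (field; lra).
  apply Rmult_le_compat_neg_l; [lra|].
  apply Rmult_le_compat_r; [apply Rlt_le, Rinv_0_lt_compat|]; lra.
Qed.
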